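(* Let $p,q\in\mathbb N$ with $p\ge q>1$, let $\varphi$ be the morphism on $\{A,B\}^*$ given by $\varphi(A)=A^pB$, $\varphi(B)=A^q$, and let ${\bf u}_\beta=\lim_{m\to\infty}\varphi^m(A)$. Let ${\bf w}=\lim_{m\to\infty}w^{(m)}$ and ${\bf v}=\lim_{m\to\infty}v^{(m)}$, where $w^{(0)}=B$, $A^pw^{(m)}=\varphi^2(w^{(m-1)})$ for all $m\in\mathbb N$, and $v^{(m)}=\varphi(w^{(m)})$ for all $m\in\mathbb N_0$. Let $u$ be a factor of ${\bf u}_\beta$, let $\hat w$ be the prefix of ${\bf w}$ of length $|u|$, and let $\hat v$ be the prefix of ${\bf v}$ of length $|u|$. Then $$|\hat w|_B\ge|u|_B\ge|\hat v|_B.$$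
   Context: $\mathbb N$ is the set of positive integers and $\mathbb N_0=\mathbb N\cup\{0\}$. For a finite word $w$ over $\{A,B\}$, $|w|$ is its length and $|w|_B$ is the number of occurrences of $B$ in $w$. A factor of an infinite word is a finite block of consecutive letters of it. The infinite word ${\bf u}_\beta$ is the infinite word having every $\varphi^m(A)$ as a prefix. The equation $A^pw^{(m)}=\varphi^2(w^{(m-1)})$ means that $w^{(m)}$ is obtained from $\varphi^2(w^{(m-1)})$ by deleting its prefix $A^p$; explicitly $w^{(m)}=B\varphi(A^{q-1})\varphi^3(A^{q-1})\cdots\varphi^{2m-1}(A^{q-1})$ and $v^{(m)}=A^q\varphi^2(A^{q-1})\varphi^4(A^{q-1})\cdots\varphi^{2m}(A^{q-1})$. Thus $w^{(m-1)}$ is a prefix of $w^{(m)}$ and $v^{(m-1)}$ is a prefix of $v^{(m)}$, and ${\bf w}$, ${\bf v}$ are the infinite words having all $w^{(m)}$, respectively all $v^{(m)}$, as prefixes. *)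

(* Defs.v *)
From HB Require Import structures.
From mathcomp Require Import all_boot.

Set Implicit Arguments.
Unset Strict Implicit.
Unset Printing Implicit Defensive.

Inductive letter := A | B.

Definition is_B (a : letter) : bool := if a is B then true else false.
Definition letter_of_bool (b : bool) : letter := if b then B else A.

Lemma is_BK : cancel is_B letter_of_bool.
Proof. by case. Qed.

HB.instance Definition _ := Equality.copy letter (can_type is_BK).

Definition word := seq letter.
Definition infword := nat -> letter.

Definition phi_letter (p q : nat) (a : letter) : word :=
  if a is A then rcons (nseq p A) B else nseq q A.

Definition phi (p q : nat) (w : word) : word :=
  flatten [seq phi_letter p q a | a <- w].

Definition inf_prefix (x : infword) (n : nat) : word := mkseq x n.

(* [x] has every [s m] as a prefix.  This determines [x] (so that [x] is the
   limit of [s]) only when the lengths of the [s m] are unbounded. *)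
Definition has_prefixes (s : nat -> word) (x : infword) : Prop :=
  forall m : nat, inf_prefix x (size (s m)) = s m.

Definition factor (u : word) (x : infword) : Prop :=
  exists i : nat, u = mkseq (fun k => x (i + k)) (size u).

(* Main.v *)
(** The infinite words satisfy [v = phi w] and [A^p w = phi v].  If all factors of
    a finite word [x] obey the two bounds, so do those of [phi x]: a factor [u] of
    [phi x] desubstitutes to a factor [z] of [x] with [|z|_A = |u|_B] and
    [||phi z| - |u|| <= p].  By the lower bound for [z], [v] has a prefix with as
    many [A]s as [z] and at most as many [B]s; its image is [A^p] followed by a
    prefix of [w] that has [|u|_B] letters [B] and length at most [|u|].
    Symmetrically, the upper bound for [z] gives a prefix of [w] followed by [A],
    with as many [A]s and at least as many [B]s, and its image followed by [A^p]
    is a prefix of [v] of length at least [|u|] with [|u|_B] letters [B]. *)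
Require Import Defs.
From HB Require Import structures.
From mathcomp Require Import all_boot.
From mathcomp Require Import zify.

Set Implicit Arguments.
Unset Strict Implicit.
Unset Printing Implicit Defensive.

(** * Letter counts of images under the morphism *)

Lemma count_A_B (s : word) : count_mem A s + count_mem B s = size s.
Proof. by elim: s => //= -[] s <- /=; lia. Qed.

Lemma phi_cons p q a s : phi p q (a :: s) = phi_letter p q a ++ phi p q s.
Proof. by []. Qed.

Lemma phi_cat p q s t : phi p q (s ++ t) = phi p q s ++ phi p q t.
Proof. by rewrite /phi map_cat flatten_cat. Qed.

Lemma count_A_phi p q s :
  count_mem A (phi p q s) = p * count_mem A s + q * count_mem B s.
Proof.
elim: s => [|a s IHs]; first by rewrite /= !muln0.
rewrite phi_cons count_cat IHs.
by case: a => /=; rewrite -?cats1 ?count_cat ?count_nseq /=; lia.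
Qed.

Lemma count_B_phi p q s : count_mem B (phi p q s) = count_mem A s.
Proof.
elim: s => // a s IHs; rewrite phi_cons count_cat IHs.
by case: a => /=; rewrite -?cats1 ?count_cat ?count_nseq /=; lia.
Qed.

Lemma size_phi p q s :
  size (phi p q s) = p.+1 * count_mem A s + q * count_mem B s.
Proof. by rewrite -count_A_B count_A_phi count_B_phi; lia. Qed.

(** * Desubstitution of factors *)

Lemma count_B_take_phi_letter p q a i :
  i < size (phi_letter p q a) -> count_mem B (take i (phi_letter p q a)) = 0.
Proof.
case: a => /=; last by rewrite size_nseq => hi; rewrite take_nseq ?count_nseq //; lia.
rewrite size_rcons size_nseq ltnS => hi.
by rewrite -cats1 takel_cat ?size_nseq // take_nseq ?count_nseq.
Qed.

(** Take for [j] the number of complete blocks in the first [i] letters. A [B] occurs only at the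
    end of a block, so the unfinished block has none, and it has at most [p] letters because
    [q <= p]. *)
Lemma take_phi p q x i : q <= p -> i <= size (phi p q x) ->
  exists j, [/\ j <= size x,
    count_mem A (take j x) = count_mem B (take i (phi p q x)),
    size (phi p q (take j x)) <= i & i <= size (phi p q (take j x)) + p].
Proof.
move=> hpq; elim: x i => [|a x IHx] i.
  by rewrite leqn0 => /eqP ->; exists 0.
rewrite phi_cons size_cat => hi.
case: (ltnP i (size (phi_letter p q a))) => hia.
  exists 0; split=> //=.
    by rewrite takel_cat ?count_B_take_phi_letter // ltnW.
  by move: hia; case: (a) => /=; rewrite ?size_rcons size_nseq; lia.
have [|j [hj hc h1 h2]] := IHx (i - size (phi_letter p q a)); first by lia.
exists j.+1; split=> //; last 2 first.
- by rewrite [take _ _]/= phi_cons size_cat; lia.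
- by rewrite [take _ _]/= phi_cons size_cat; lia.
rewrite take_cat ltnNge hia /= count_cat -hc; congr (_ + _).
by case: (a); rewrite /= -?cats1 ?count_cat count_nseq.
Qed.

Lemma desubstitute p q x s u t : q <= p -> phi p q x = s ++ u ++ t ->
  exists s' z t', [/\ x = s' ++ z ++ t', count_mem A z = count_mem B u,
    size (phi p q z) <= size u + p & size u <= size (phi p q z) + p].
Proof.
move=> hpq e.
have [|i [hi ci i1 i2]] := @take_phi p q x (size s) hpq.
  by rewrite e size_cat leq_addr.
have [|j [hj cj j1 j2]] := @take_phi p q x (size s + size u) hpq.
  by rewrite e !size_cat; lia.
have es : take (size s) (phi p q x) = s by rewrite e take_size_cat.
have esu : take (size s + size u) (phi p q x) = s ++ u.
  by rewrite e catA take_size_cat // size_cat.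
move: ci cj; rewrite es esu count_cat => ci cj.
case: (leqP i j) => hij.
  have [z ej] : exists z, take j x = take i x ++ z.
    by exists (drop i (take j x)); rewrite -[LHS](cat_take_drop i) take_takel.
  move: cj j1 j2; rewrite ej count_cat phi_cat size_cat => cj j1 j2.
  exists (take i x), z, (drop j x).
  by rewrite catA -ej cat_take_drop; split=> //; lia.
(* [take_phi] does not order its two cuts. If they come reversed, [u] has no [B] and at most [p]
   letters, so the empty word serves as [z]. *)
have ei : take i x = take j x ++ drop j (take i x).
  by rewrite -[LHS](cat_take_drop j) take_takel // ltnW.
move: ci i1 i2; rewrite ei count_cat phi_cat size_cat => ci i1 i2.
have u0 : count_mem B u = 0 by lia.
by exists [::], [::], x; rewrite u0; split=> //=; lia.
Qed.

(** * Letter counts in prefixes of infinite words *)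

Definition count_B_prefix (x : infword) (n : nat) := count_mem B (inf_prefix x n).

Lemma count_B_prefixS x n :
  count_B_prefix x n.+1 = count_B_prefix x n + is_B (x n).
Proof.
rewrite /count_B_prefix /inf_prefix mkseqS -cats1 count_cat /= addn0.
by case: (x n).
Qed.

Lemma leq_count_B_prefix x m n : m <= n ->
  count_B_prefix x m <= count_B_prefix x n <= count_B_prefix x m + (n - m).
Proof.
move=> hmn; rewrite -{1 2}(subnK hmn); elim: (n - m) => [|k IHk].
  by rewrite addn0 leqnn.
by rewrite addSn count_B_prefixS; case: (x _) => /=; lia.
Qed.

Lemma count_A_prefix x n :
  count_mem A (inf_prefix x n) + count_B_prefix x n = n.
Proof. by rewrite count_A_B size_mkseq. Qed.

(** The number of [A]s grows by at most one per letter; [k + count_B_prefix x n = n] expresses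
    without subtraction that it equals [k]. *)
Lemma prefix_with_count_A x m k : k + count_B_prefix x m <= m ->
  exists2 n, n <= m & k + count_B_prefix x n = n.
Proof.
elim: m => [|m IHm] hk; first by exists 0 => //; lia.
case: (leqP (k + count_B_prefix x m) m) => [/IHm[n hn en]|hlt].
  by exists n => //; lia.
by exists m.+1 => //; move: hk; rewrite count_B_prefixS; lia.
Qed.

(** Here [n] is the position of the [A] preceded by exactly [k] others. The prefix stopping just
    before it is the longest with [k] letters [A], so it covers the first [m] letters. *)
Lemma prefix_before_A x m N k : m <= k + count_B_prefix x m ->
  k + count_B_prefix x N < N ->
  exists n, [/\ m <= n, k + count_B_prefix x n = n & x n = A].
Proof.
move=> hm; elim: N => // N IHN hN.
case: (ltnP (k + count_B_prefix x N) N) => [/IHN //|hN'].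
case ex: (x N); have := count_B_prefixS x N; rewrite ex /= => eS; last by lia.
exists N; split=> //; last by lia.
rewrite leqNgt; apply/negP => lt_Nm.
have := leq_count_B_prefix x lt_Nm; lia.
Qed.

Definition is_prefix (s : word) (x : infword) := inf_prefix x (size s) = s.

Lemma is_prefix_catl s t x : is_prefix (s ++ t) x -> is_prefix s x.
Proof.
rewrite /is_prefix /inf_prefix size_cat => e.
have := congr1 (take (size s)) e.
by rewrite take_size_cat // /mkseq -map_take take_iota (minn_idPl _) ?leq_addr.
Qed.

Lemma count_B_is_prefix s x :
  is_prefix s x -> count_B_prefix x (size s) = count_mem B s.
Proof. by rewrite /count_B_prefix => ->. Qed.

Lemma has_prefixes_split s x n : has_prefixes s x ->
  (forall m, m <= size (s m)) -> exists t, s n = inf_prefix x n ++ t.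
Proof.
move=> hs hsz; exists (drop n (s n)).
rewrite -{1}(cat_take_drop n (s n)); congr (_ ++ _).
rewrite -{1}(hs n) /inf_prefix /mkseq -map_take take_iota.
by rewrite (minn_idPl _).
Qed.

Lemma leq_size_phi p q s : 0 < q -> size s <= size (phi p q s).
Proof. by move=> hq; rewrite size_phi -count_A_B; nia. Qed.

Definition factors_bounded (w v : infword) (x : word) := forall s u t,
  x = s ++ u ++ t ->
  count_B_prefix v (size u) <= count_mem B u <= count_B_prefix w (size u).

Lemma size_approximants_gt p q (wm : nat -> word) :
  0 < p -> 1 < q -> wm 0 = [:: B] ->
  (forall m, nseq p A ++ wm m.+1 = phi p q (phi p q (wm m))) ->
  forall m, m < size (wm m).
Proof.
move=> hp hq h0 hS; elim=> [|m IHm]; first by rewrite h0.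
have := congr1 size (hS m); rewrite size_cat size_nseq [in RHS]size_phi.
rewrite count_A_phi count_B_phi; move: IHm; rewrite -count_A_B.
move: (count_mem A _) (count_mem B _) => a b IHm e.
have [ha hb hqa] : [/\ a <= p * a, 2 * b <= q * b & 2 * a <= q * a].
  by rewrite leq_pmull // !leq_mul.
have ht : a + b < (p * a + q * b) + q * a by lia.
(* This part of the new length pays for the deleted [A^p]; by [ht] the rest exceeds [a + b]. *)
have hpt : p <= p * (p * a + q * b) by rewrite leq_pmulr //; lia.
lia.
Qed.

(** * Images of prefixes of [w] and [v] *)

(* Finite form of [v = phi w] and [A^p w = phi v]. *)
Definition phi_related p q (w v : infword) := [/\ v 0 = A,
  forall n, is_prefix (phi p q (inf_prefix w n)) v &
  forall n s, phi p q (inf_prefix v n) = nseq p A ++ s -> is_prefix s w].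

(** The next letter [A] has image [A^p B], whose [A^p] lengthens the prefix of [v] by [p] without
    adding a [B]. *)
Lemma count_B_image_w p q w v n : phi_related p q w v -> w n = A ->
  count_B_prefix v (size (phi p q (inf_prefix w n)) + p) =
  count_mem A (inf_prefix w n).
Proof.
move=> [_ phi_w _] wnA; have := phi_w n.+1.
rewrite {1}/inf_prefix mkseqS wnA -cats1 phi_cat phi_cons /= -cats1 -catA catA.
move=> /is_prefix_catl /count_B_is_prefix.
by rewrite size_cat size_nseq count_cat count_B_phi count_nseq /= addn0.
Qed.

(** Since [v] begins with [A], the image of a nonempty prefix begins with the [A^p] to be deleted,
    and no [B] is lost. *)
Lemma count_B_image_v p q w v n : phi_related p q w v -> 0 < n ->
  count_B_prefix w (size (phi p q (inf_prefix v n)) - p) =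
  count_mem A (inf_prefix v n).
Proof.
move=> [v0 _ phi_v]; case: n => // n _; rewrite -(count_B_phi p q).
have e : inf_prefix v n.+1 = A :: mkseq (fun k => v k.+1) n.
  by rewrite /inf_prefix /mkseq /= v0 -[1]addn0 iotaDl -map_comp.
have e2 : phi p q (inf_prefix v n.+1) =
    nseq p A ++ B :: phi p q (mkseq (fun k => v k.+1) n).
  by rewrite e phi_cons /= cat_rcons.
rewrite e2 size_cat size_nseq addKn count_cat count_nseq /=.
by rewrite (count_B_is_prefix (phi_v _ _ e2)).
Qed.

Lemma count_A_prefix_unbounded p q w v k : 0 < p -> 0 < q -> phi_related p q w v ->
  exists N, k + count_B_prefix w N < N.
Proof.
move=> hp hq hwv; have [v0 _ _] := hwv.
(* An image has at least as many [A]s as its source has letters; [p] of them are deleted, so at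
   least [k.+1] remain. *)
exists (size (phi p q (inf_prefix v (p + k).+1)) - p).
rewrite (count_B_image_v hwv) //.
have := count_A_prefix v (p + k).+1; rewrite size_phi -/(count_B_prefix _ _).
have : 0 < count_mem A (inf_prefix v (p + k).+1).
  by rewrite /inf_prefix /mkseq /= v0.
nia.
Qed.

Lemma factors_bounded_phi p q w v x :
  q <= p -> 0 < q -> phi_related p q w v ->
  factors_bounded w v x -> factors_bounded w v (phi p q x).
Proof.
move=> hpq hq hwv hx s u t e.
have [s' [z [t' [ex cz z1 z2]]]] := desubstitute hpq e.
have /andP[hv hw] := hx _ _ _ ex.
move: z1 z2; rewrite size_phi cz => z1 z2.
have sz := count_A_B z.
apply/andP; split.
  have [N hN] := count_A_prefix_unbounded (count_mem B u) (leq_trans hq hpq) hq hwv.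
  have [|n [hn en wnA]] := @prefix_before_A w (size z) N (count_mem B u) _ hN.
    by lia.
  have := count_B_image_w hwv wnA.
  have := leq_count_B_prefix w hn.
  have := count_A_prefix w n.
  rewrite size_phi -/(count_B_prefix _ _) => e1 e2 e3.
  have ek : count_mem B u = count_mem A (inf_prefix w n) by lia.
  rewrite ek -e3.
  (* The prefix of [w] has as many [A]s as [z] and at least as many [B]s, so its image is no shorter
     than [phi p q z], which misses at most [p] letters of [size u]. *)
  suff /(leq_count_B_prefix v)/andP[] : size u <=
      p.+1 * count_mem A (inf_prefix w n) + q * count_B_prefix w n + p by [].
  nia.
(* The case of no [B] in [u] is trivial and set apart because [count_B_image_v] needs a nonempty
   prefix. *)
have [|k_gt0] := posnP (count_mem B u); first by move->.
have [|n hn en] := @prefix_with_count_A v (size z) (count_mem B u); first by lia.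
have := count_B_image_v hwv (n := n).
have := leq_count_B_prefix v hn.
have := count_A_prefix v n.
rewrite size_phi -/(count_B_prefix _ _) => e1 e2 e3.
have ek : count_mem B u = count_mem A (inf_prefix v n) by lia.
rewrite ek -e3; last by lia.
suff /(leq_count_B_prefix w)/andP[] :
    p.+1 * count_mem A (inf_prefix v n) + q * count_B_prefix v n - p <= size u
  by [].
nia.
Qed.

Theorem proposition6p3 (p q : nat) (hpq : q <= p) (hq : 1 < q)
  (u_beta : infword)
  (hu_beta : has_prefixes (fun m => iter m (phi p q) [:: A]) u_beta)
  (wm vm : nat -> word)
  (hw0 : wm 0 = [:: B])
  (hwS : forall m : nat, nseq p A ++ wm m.+1 = phi p q (phi p q (wm m)))
  (hvm : forall m : nat, vm m = phi p q (wm m))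
  (w v : infword) (hw : has_prefixes wm w) (hv : has_prefixes vm v)
  (u : word) (hu : factor u u_beta) :
  count_mem B u <= count_mem B (inf_prefix w (size u)) /\
  count_mem B (inf_prefix v (size u)) <= count_mem B u.
Proof.
have size_wm := size_approximants_gt (leq_trans (ltnW hq) hpq) hq hw0 hwS.
have size_vm m : m <= size (vm m).
  by rewrite hvm (leq_trans (ltnW (size_wm m))) // leq_size_phi // ltnW.
have phi_w n : is_prefix (phi p q (inf_prefix w n)) v.
  have [t et] := has_prefixes_split n hw (fun m => ltnW (size_wm m)).
  by apply: (@is_prefix_catl _ (phi p q t)); rewrite -phi_cat -et -hvm; exact: hv.
have phi_v n s : phi p q (inf_prefix v n) = nseq p A ++ s -> is_prefix s w.
  move=> es; have [t et] := has_prefixes_split n hv size_vm.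
  apply: (@is_prefix_catl _ (phi p q t)).
  have := hwS n; rewrite -hvm et phi_cat es -catA => /(congr1 (drop p)).
  by rewrite !drop_size_cat ?size_nseq // => <-; exact: hw.
have v0 : v 0 = A.
  have := hv 0; rewrite hvm hw0 /phi /= cats0 size_nseq.
  by case: (q) hq => // q' _ [].
have w0 : w 0 = B by have := hw 0; rewrite hw0; case.
have bounded m : factors_bounded w v (iter m (phi p q) [:: A]).
  elim: m => [|m IHm]; last first.
    exact: factors_bounded_phi (ltnW hq) _ IHm.
  move=> s [|a u'] t; first by [].
  case: s => [|b s] /=; last by case: s.
  case: u' => [|b u'] //= -[<- _].
  by rewrite /count_B_prefix /inf_prefix /= v0 w0.
have size_iter m : m < size (iter m (phi p q) [:: A]).
  (* An [A] is carried along in the induction: its image has [p.+1] letters, which makes the growth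
     strict. *)
  have [] : 0 < count_mem A (iter m (phi p q) [:: A]) /\
            m < size (iter m (phi p q) [:: A]) => //.
  elim: m => // m [IHA IHm]; rewrite iterS count_A_phi size_phi.
  by move: IHm; rewrite -count_A_B; nia.
case: hu => i ui.
(* The first [i + size u] letters contain [u] and begin a finite iterate, to which [bounded]
   applies. *)
have [t et] := has_prefixes_split (i + size u) hu_beta (fun m => ltnW (size_iter m)).
have eu : inf_prefix u_beta (i + size u) = inf_prefix u_beta i ++ u.
  rewrite [in RHS]ui /inf_prefix /mkseq iotaD map_cat add0n; congr (_ ++ _).
  by rewrite -[in LHS](addn0 i) iotaDl -map_comp.
by move: et; rewrite eu -catA => /bounded /andP[].
Qed.
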